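(* Every finite group $G$ satisfies $\eta(G)\ge\pi(|G|)+1$, with equality if and only if every nontrivial element of $G$ has prime order.
   Context: For a finite group $G$, $\omega(G)$ denotes the set of orders of elements of $G$ and $\eta(G)=|\omega(G)|$. For a positive integer $m$, $\pi(m)$ denotes the number of distinct primes dividing $m$. *)

(* Defs.v *)
From mathcomp Require Import all_boot all_fingroup.

Set Implicit Arguments.
Unset Strict Implicit.
Unset Printing Implicit Defensive.

(* The finite set omega(G) is represented by a duplicate-free sequence. *)
Definition omega (gT : finGroupType) (G : {group gT}) : seq nat :=
  undup [seq #[x]%g | x in G].

Definition eta (gT : finGroupType) (G : {group gT}) : nat := size (omega G).

(* The number of distinct prime divisors of m, and not, as in MathComp's
   \pi(m), the set of these primes. *)
Definition num_primes (m : nat) : nat := size (primes m).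

(* Main.v *)
Require Import Defs.
From mathcomp Require Import all_boot all_fingroup.
From mathcomp Require Import cyclic pgroup.

(** By Cauchy's theorem every prime divisor of #|G| is the order of an element
    of G, and 1 is the order of the identity. The duplicate-free sequence
    consisting of 1 and the primes dividing #|G| is therefore contained in
    omega(G) (lemma [sub_primes_omega]), which gives the inequality. Since both
    sequences are duplicate-free, equality of sizes amounts to the reverse
    inclusion: every element order is 1 or a prime divisor of #|G|. By
    Lagrange's theorem an element order divides #|G|, so this says that the
    nontrivial elements have prime order. *)

Lemma omegaP (gT : finGroupType) (G : {group gT}) (n : nat) :
  reflect (exists2 x : gT, x \in G & n = #[x]%g) (n \in omega G).
Proof. by rewrite mem_undup; apply: imageP. Qed.

Lemma uniq_one_primes (n : nat) : uniq (1 :: primes n).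
Proof. by rewrite /= primes_uniq mem_primes. Qed.

(** Cauchy's theorem, read as an inclusion of sets of orders. *)
Lemma sub_primes_omega (gT : finGroupType) (G : {group gT}) :
  {subset 1 :: primes #|G| <= omega G}.
Proof.
move=> p; rewrite inE => /predU1P[->|].
  by apply/omegaP; exists 1%g; rewrite ?group1 ?order1.
rewrite mem_primes => /and3P[p_pr _ /(Cauchy p_pr)[x Gx ox]].
by apply/omegaP; exists x.
Qed.

Theorem theorem4p2 (gT : finGroupType) (G : {group gT}) :
  num_primes #|G| + 1 <= eta G /\
  (eta G = num_primes #|G| + 1 <->
   (forall x : gT, x \in G -> x != 1%g -> prime #[x]%g)).
Proof.
have size_le : num_primes #|G| + 1 <= eta G.
  rewrite addn1.
  exact: uniq_leq_size (uniq_one_primes _) (@sub_primes_omega _ G).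
split=> //; split=> [size_eq x Gx x_neq1 | prime_order].
  have size_omega : size (omega G) <= size (1 :: primes #|G|).
    by rewrite -/(eta G) size_eq addn1.
  have [_ eq_orders] := uniq_min_size (uniq_one_primes _)
    (@sub_primes_omega _ G) size_omega.
  have : #[x]%g \in omega G by apply/omegaP; exists x.
  rewrite -eq_orders inE order_eq1 (negPf x_neq1) mem_primes.
  by case/andP.
apply/eqP; rewrite eqn_leq size_le andbT addn1.
apply: (@uniq_leq_size _ (omega G) (1 :: primes #|G|)) => [|n].
  exact: undup_uniq.
case/omegaP=> x Gx ->; rewrite inE order_eq1.
case: eqVneq => //= x_neq1.
by rewrite mem_primes prime_order // cardG_gt0 order_dvdG.
Qed.
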